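(* Let $X,Y$ be real Hausdorff locally convex topological vector spaces, $\varphi:X\times Y\to\overline{\mathbb R}$ a function and $G:X\rightrightarrows Y$ a set-valued map. Let $\mu(x)=\inf\{\varphi(x,y)\mid y\in G(x)\}$ and $M(x)=\{y\in G(x)\mid\mu(x)=\varphi(x,y)\}$ for $x\in X$. Suppose that at least one of the following conditions is satisfied: (i) $\varphi$ is proper polyhedral convex and $G$ is generalized polyhedral convex; (ii) $\varphi$ is proper generalized polyhedral convex and $G$ is polyhedral convex. Then, for any $\bar x\in X$ with $\mu(\bar x)\in\mathbb R$ and for any $\bar y\in M(\bar x)$, one has $$\partial\mu(\bar x)=A_0=A=B_0=B,$$ where $$A_0=\bigcup_{(x^*,y^* )\in\partial\varphi(\bar x,\bar y)}\{x^*+D^*G(\bar x,\bar y)(y^* )\},\qquad A=\overline{A_0},$$ $$B_0=\mathrm{pr}_{X^*}\Big[\big(\partial\varphi(\bar x,\bar y)+N((\bar x,\bar y);\mathrm{gph}\,G)\big)\cap(X^*\times\{0\})\Big],$$ $$B=\mathrm{pr}_{X^*}\Big[\overline{\partial\varphi(\bar x,\bar y)+N((\bar x,\bar y);\mathrm{gph}\,G)}\cap(X^*\times\{0\})\Big].$$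
   Context: $\overline{\mathbb R}=\mathbb R\cup\{\pm\infty\}$, $\inf\emptyset=+\infty$. Dual spaces $X^*$, $Y^*$ carry the weak$^*$ topology, $(X\times Y)^*$ is identified with $X^*\times Y^*$, and an overline over a subset of a dual space is the weak$^*$ closure. $\mathrm{pr}_{X^*}:X^*\times Y^*\to X^*$, $(x^*,y^* )\mapsto x^*$. A function $f:Z\to\overline{\mathbb R}$ is proper if $\mathrm{dom}\,f=\{z\mid f(z)<+\infty\}\ne\emptyset$ and $f(z)\neq-\infty$ for all $z$; $\mathrm{epi}\,f=\{(z,\lambda)\in Z\times\mathbb R\mid f(z)\le\lambda\}$; $f$ is convex if $\mathrm{epi}\,f$ is convex. For a set-valued map, $\mathrm{gph}\,G=\{(x,y)\mid y\in G(x)\}$. A subset $D$ of a real Hausdorff locally convex space $Z$ is a generalized polyhedral convex set if $D=\{z\in L\mid \langle z_i^*,z\rangle\le\alpha_i,\ i=1,\dots,p\}$ for some $z_i^*\in Z^*$, $\alpha_i\in\mathbb R$, and some closed affine subspace $L\subset Z$; it is a polyhedral convex set if it has such a representation with $L=Z$. A function (resp. set-valued map) is (generalized) polyhedral convex if its epigraph (resp. its graph) is a (generalized) polyhedral convex set. Normal cone to a convex set $C$: $N(\bar z;C)=\{z^*\mid\langle z^*,z-\bar z\rangle\le0\ \forall z\in C\}$ if $\bar z\in C$, and $\emptyset$ otherwise. For convex $f$ with $f(\bar z)\in\mathbb R$: $\partial f(\bar z)=\{z^*\mid\langle z^*,z-\bar z\rangle\le f(z)-f(\bar z)\ \forall z\in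 Z\}$; it is $\emptyset$ if $f(\bar z)\notin\mathbb R$. Coderivative of a convex set-valued map $G$ (one with convex graph) at $(\bar x,\bar y)\in\mathrm{gph}\,G$: $D^*G(\bar x,\bar y)(y^* )=\{x^*\in X^*\mid(x^*,-y^* )\in N((\bar x,\bar y);\mathrm{gph}\,G)\}$ for $y^*\in Y^*$. Under the stated assumptions $\mu$ is a convex function. *)

(* Defs.v *)
From HB Require Import structures.
From mathcomp Require Import all_boot all_order all_algebra.
From mathcomp Require Import all_classical all_reals all_analysis.

Set Implicit Arguments.
Unset Strict Implicit.
Unset Printing Implicit Defensive.
Import Order.TTheory GRing.Theory Num.Theory.
Import numFieldNormedType.Exports.
Local Open Scope classical_set_scope.
Local Open Scope ring_scope.

Section Dual.
Variables (R : realType) (Z : tvsType R).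

Definition continuous_functional : {pred Z -> R^o} :=
  fun f => `[< linear f /\ continuous f >].

Record dual_space : Type := Dual {
  functional :> Z -> R^o;
  functionalP : functional \in continuous_functional }.

HB.instance Definition _ := [isSub for functional].
HB.instance Definition _ := [Choice of dual_space by <:].

Lemma functional_linear (f : dual_space) : linear f.
Proof. by have /asboolP[] := functionalP f. Qed.

Lemma functional_continuous (f : dual_space) : continuous f.
Proof. by have /asboolP[] := functionalP f. Qed.

HB.instance Definition _ (f : dual_space) :=
  GRing.isLinear.Build R Z R^o *:%R (functional f) (functional_linear f).

Lemma continuous_functional_submod : submod_closed continuous_functional.
Proof.
split=> [|a f g /asboolP[lf cf] /asboolP[lg cg]]; apply/asboolP; split.
- by move=> a x y /=; rewrite /GRing.zero /= scaler0 addr0.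
- by move=> x; exact: cvg_cst.
- move=> b x y; rewrite -[LHS]/(a *: f (b *: x + y) + g (b *: x + y)).
  rewrite -[RHS]/(b *: (a *: f x + g x) + (a *: f y + g y)) lf lg.
  by rewrite !scalerDr !scalerA (mulrC a b) addrACA.
- move=> x; apply: cvgD; last exact: cg.
  by apply: cvgZ; [exact: cvg_cst|exact: cf].
Qed.

HB.instance Definition _ := GRing.isSubmodClosed.Build R (Z -> R^o)
  continuous_functional continuous_functional_submod.
HB.instance Definition _ := [SubChoice_isSubLmodule of dual_space by <:].

(* the weak* topology: pointwise convergence on Z *)
HB.instance Definition _ := Topological.copy dual_space
  (initial_topology (functional : dual_space -> {ptws Z -> R^o})).

End Dual.

Section DualPair.
Variables (R : realType) (X Y : tvsType R).

Lemma dual_pair_subproof (p : dual_space X * dual_space Y) :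
  (fun z : X * Y => p.1 z.1 + p.2 z.2 : R^o)
    \in @continuous_functional R (X * Y)%type.
Proof.
apply/asboolP; split=> [a u v /=|z].
  by rewrite !linearP scalerDr addrACA.
apply: (@cvgD _ R^o).
- apply: (@continuous_comp _ _ _ fst p.1); first exact: cvg_fst.
  exact: functional_continuous.
- apply: (@continuous_comp _ _ _ snd p.2); first exact: cvg_snd.
  exact: functional_continuous.
Qed.

(* the identification of X^* x Y^* with (X x Y)^* *)
Definition dual_pair (p : dual_space X * dual_space Y) : dual_space (X * Y)%type :=
  Dual (dual_pair_subproof p).

Lemma dual_pair_bij : bijective dual_pair.
Proof.
have P1 (w : dual_space (X * Y)%type) :
    (fun x : X => w (x, 0)) \in @continuous_functional R X.
  apply/asboolP; split=> [a u v|x].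
    by rewrite -linearP /=; congr (w (_, _)); rewrite /= scaler0 addr0.
  apply: (@continuous_comp _ _ _ (fun x => (x, 0)) w).
    by apply: cvg_pair; [exact: cvg_id|exact: cvg_cst].
  exact: functional_continuous.
have P2 (w : dual_space (X * Y)%type) :
    (fun y : Y => w (0, y)) \in @continuous_functional R Y.
  apply/asboolP; split=> [a u v|y].
    by rewrite -linearP /=; congr (w (_, _)); rewrite /= scaler0 addr0.
  apply: (@continuous_comp _ _ _ (fun y => (0, y)) w).
    by apply: cvg_pair; [exact: cvg_cst|exact: cvg_id].
  exact: functional_continuous.
exists (fun w => (Dual (P1 w), Dual (P2 w))) => [[f g]|w].
  congr (_, _); apply: val_inj; apply/funext => z /=.
    by rewrite linear0 addr0.
  by rewrite linear0 add0r.
apply: val_inj; apply/funext => -[x y] /=; rewrite -linearD /=.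
by congr (w (_, _)); rewrite ?addr0 ?add0r.
Qed.

End DualPair.

Section Polyhedral.
Variables (R : realType) (Z : tvsType R).

(* the empty set counts as affine; it is a polyhedral set in any case, being
   cut out by the inequality 0 <= -1 *)
Definition affine_subspace (L : set Z) : Prop :=
  forall (x y : Z) (t : R), L x -> L y -> L ((1 - t) *: x + t *: y).

Definition polyhedral_in (L D : set Z) : Prop :=
  exists (p : nat) (zs : 'I_p -> dual_space Z) (alpha : 'I_p -> R),
    D = [set z | L z /\ forall i, zs i z <= alpha i].

Definition gen_polyhedral_convex_set (D : set Z) : Prop :=
  exists L : set Z, [/\ closed L, affine_subspace L & polyhedral_in L D].

Definition polyhedral_convex_set (D : set Z) : Prop := polyhedral_in setT D.

End Polyhedral.

Section ConvexAnalysis.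
Variables (R : realType) (Z : tvsType R).
Implicit Types (f : Z -> \bar R) (C : set Z).

Definition proper_fun f : Prop :=
  (exists z, (f z < +oo)%E) /\ (forall z, f z != -oo%E).

Definition epi f : set (Z * R^o) := [set p | (f p.1 <= p.2%:E)%E].

Definition polyhedral_convex_fun f : Prop := polyhedral_convex_set (epi f).

Definition gen_polyhedral_convex_fun f : Prop :=
  gen_polyhedral_convex_set (epi f).

Definition normal_cone (z0 : Z) C : set (dual_space Z) :=
  [set zs | C z0 /\ forall z, C z -> zs (z - z0) <= 0].

Definition subdifferential f (z0 : Z) : set (dual_space Z) :=
  [set zs | f z0 \is a fin_num /\
            forall z, ((zs (z - z0))%:E <= f z - f z0)%E].

End ConvexAnalysis.

Section SetValuedMap.
Variables (R : realType) (X Y : tvsType R).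
Implicit Types (G : X -> set Y) (phi : X * Y -> \bar R).

Definition gph G : set (X * Y) := [set p | G p.1 p.2].

Definition polyhedral_convex_map G : Prop := polyhedral_convex_set (gph G).

Definition gen_polyhedral_convex_map G : Prop :=
  gen_polyhedral_convex_set (gph G).

Definition coderivative G (x : X) (y : Y) (ys : dual_space Y) : set (dual_space X) :=
  [set xs | normal_cone (x, y) (gph G) (dual_pair (xs, - ys))].

Definition optimal_value phi G (x : X) : \bar R :=
  ereal_inf [set phi (x, y) | y in G x].

Definition solution_map phi G (x : X) : set Y :=
  [set y | G x y /\ optimal_value phi G x = phi (x, y)].

End SetValuedMap.

(* Main.v *)
(** With phi extended by +oo outside gph G, a functional xs is a subgradient of
    mu at x0 iff (xs, 0) is a subgradient of the extended function at (x0, y0).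
    Subdifferentials are weak* closed, so everything follows from the exact sum
    rule S = d(phi + indicator of gph G)(x0, y0).  In X * Y * R, that rule splits
    the normal cone to the intersection of epi phi and gph G * R.  By Farkas'
    lemma on the direction space of the affine part of the generalized
    polyhedral set, a normal functional is a nonnegative combination of active
    constraints up to a functional vanishing on that space; as only one of the
    two sets carries an affine constraint, the vanishing part is assigned to it
    and no Hahn-Banach argument is needed. *)
Require Import Defs.
From HB Require Import structures.
From mathcomp Require Import all_boot all_order all_algebra.
From mathcomp Require Import all_classical all_reals all_analysis.
From mathcomp Require Import ring lra.

Set Implicit Arguments.
Unset Strict Implicit.
Unset Printing Implicit Defensive.
Import Order.TTheory GRing.Theory Num.Theory.
Import numFieldNormedType.Exports.
Local Open Scope classical_set_scope.
Local Open Scope ring_scope.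

(* The complementarity [lam i * s i = 0] selects the constraints active at 0.
   In the induction step, if dropping constraint 0 breaks the implication at
   some [v], then [s ord0 = 0] (otherwise scale [v] down), and the induction
   hypothesis applies on the hyperplane [a ord0 = 0], along [v]. *)
Lemma farkas (R : realType) (V : lmodType R) (p : nat)
    (a : 'I_p -> {linear V -> R^o}) (s : 'I_p -> R) (f : {linear V -> R^o})
    (W : set V) :
  (forall t x y, W x -> W y -> W (t *: x + y)) ->
  (forall i, 0 <= s i) ->
  (forall x, W x -> (forall i, a i x <= s i) -> f x <= 0) ->
  exists lam : 'I_p -> R,
    [/\ forall i, 0 <= lam i, forall i, lam i * s i = 0 &
        forall x, W x -> f x = \sum_i lam i * a i x].
Proof.
elim: p a s W => [|p IHp] a s W Wlin s_ge0 f_le0.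
  exists (fun=> 0); split=> [||x Wx]; [by case|by case|rewrite big_ord0].
  have f_le0' y : W y -> f y <= 0 by move=> Wy; apply: f_le0 => // -[].
  apply/le_anti; rewrite f_le0'//=.
  (* [-2 *: x + x] is [- x], so this yields [0 <= f x]. *)
  have := f_le0' _ (Wlin (-2) _ _ Wx Wx).
  by rewrite linearP /= /GRing.scale /=; lra.
have [f_le0'|/existsNP[v /not_implyP[Wv /not_implyP[av /negP]]]] := pselect
  (forall x, W x -> (forall i, a (lift ord0 i) x <= s (lift ord0 i)) ->
    f x <= 0).
  have [lam [lam_ge0 lams flam]] := IHp _ _ W Wlin
    (fun i => s_ge0 (lift ord0 i)) f_le0'.
  exists (fun i => oapp lam 0 (unlift ord0 i)); split.
  - by move=> i; case: unliftP => *; [exact: lam_ge0|].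
  - by move=> i; case: unliftP => [j|] ->; rewrite ?mul0r //=.
  - move=> x Wx; rewrite big_ord_recl unlift_none /= mul0r add0r flam//.
    by apply: eq_bigr => i _; rewrite liftK.
rewrite -ltNge => fv_gt0.
have c_gts : s ord0 < a ord0 v.
  rewrite ltNge; apply/negP => c_le; move: fv_gt0; rewrite ltNge f_le0// => i.
  by case: (unliftP ord0 i) => [j|] ->.
have c_gt0 : 0 < a ord0 v := le_lt_trans (s_ge0 _) c_gts.
have s0 : s ord0 = 0.
  apply/eqP; rewrite eq_le s_ge0 andbT leNgt; apply/negP => s_gt0.
  pose t := s ord0 / a ord0 v.
  have t_gt0 : 0 < t by rewrite divr_gt0.
  have t_le1 : t <= 1 by rewrite ler_pdivrMr// mul1r ltW.
  have Wt : W (t *: v).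
    by rewrite -[t](subrK 1) scalerDl scale1r; exact: Wlin.
  suff : f (t *: v) <= 0.
    by rewrite linearZ /= leNgt => /negP; apply; rewrite mulr_gt0.
  apply: f_le0 => // i; rewrite linearZ /= /GRing.scale /=.
  case: (unliftP ord0 i) => [j|] ->; last by rewrite /t divfK// gt_eqF.
  apply: (le_trans (ler_wpM2l (ltW t_gt0) (av j))).
  by rewrite ler_piMl.
have Wlin' t x y : (W `&` [set x | a ord0 x = 0]) x ->
    (W `&` [set x | a ord0 x = 0]) y ->
    (W `&` [set x | a ord0 x = 0]) (t *: x + y).
  move=> [Wx ax] [Wy ay]; split; first exact: Wlin.
  by rewrite /= linearP /= ax ay scaler0 addr0.
have [x [Wx /= ax] ale|lam [lam_ge0 lams flam]] := IHp
    (fun i => a (lift ord0 i)) (fun i => s (lift ord0 i)) _ Wlin' (fun i => s_ge0 _).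
  apply: f_le0 => // i; case: (unliftP ord0 i) => [j|] -> //.
  by rewrite ax.
(* The identity at [v] forces this value. It is nonnegative because [f v > 0], while the sum is at
   most the sum of the products in [lams], which is 0. *)
pose l0 : R := (f v - \sum_i lam i * a (lift ord0 i) v) / a ord0 v.
exists (fun i => oapp lam l0 (unlift ord0 i)); split.
- move=> i; case: unliftP => [j|] _ //=.
  rewrite divr_ge0 ?ltW// subr_gt0 (le_lt_trans _ fv_gt0)//.
  by apply: sumr_le0 => j _; rewrite -(lams j) ler_wpM2l.
- by move=> i; case: unliftP => [j|] ->; rewrite ?s0 ?mulr0 //=.
- move=> x Wx; rewrite big_ord_recl unlift_none /=.
  under eq_bigr do rewrite liftK /=.
  (* Shifting [x] by [- r *: v] lands in the hyperplane [a ord0 = 0], where [flam] applies. *)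
  pose r : R := a ord0 x / a ord0 v.
  have /flam : (W `&` [set x | a ord0 x = 0]) (- r *: v + x).
    split; first exact: Wlin.
    by rewrite /= linearP /= /GRing.scale /= mulNr divfK ?gt_eqF// addNr.
  rewrite linearP /= /GRing.scale /=.
  under eq_bigr do rewrite linearP /= mulrDr /GRing.scale /= mulrCA.
  rewrite big_split -mulr_sumr /= => E.
  have shift (u w y z : R) : - r * u + w = - r * y + z -> w = r * (u - y) + z.
    by move=> ?; lra.
  rewrite {}(shift _ _ _ _ E) {shift E}; congr (_ + _).
  by rewrite /l0 /r mulrAC -mulrA mulrC -!mulrA.
Qed.

(** * Weak* closed subdifferentials and normal cones of intersections *)

Section Dual.
Context {R : realType} {Z : tvsType R}.

Lemma dualDE (f g : dual_space Z) z : (f + g) z = f z + g z.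
Proof. by []. Qed.

Lemma dualNE (f : dual_space Z) z : (- f) z = - f z.
Proof. by []. Qed.

Lemma dual_sumE (I : finType) (F : I -> dual_space Z) z :
  (\sum_i F i) z = \sum_i F i z.
Proof. by elim/big_rec2 : _ => // i y1 y2 _ <-. Qed.

Lemma dualZE (t : R) (f : dual_space Z) z : (t *: f) z = t * f z.
Proof. by []. Qed.

Lemma dual_eval_continuous (z : Z) :
  continuous (fun f : dual_space Z => f z : R^o).
Proof.
move=> f; have ev := @proj_continuous Z (fun=> R^o : topologicalType) z.
apply: (@continuous_comp _ _ _ (@functional R Z : _ -> {ptws Z -> R^o})
  (fun g : {ptws Z -> R^o} => g z)).
  exact: initial_continuous.
exact: ev.
Qed.

(** Each subgradient inequality constrains one evaluation [zs (z - z0)], which is weak* continuous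
    in [zs]; convexity of [f] does not enter. *)
Lemma subdifferential_closed (f : Z -> \bar R) z0 :
  closed (subdifferential f z0).
Proof.
have [fz0|fz0] := boolP (f z0 \is a fin_num); last first.
  rewrite (_ : subdifferential _ _ = set0); first exact: closed0.
  by apply/seteqP; split=> zs // [fz0']; rewrite fz0' in fz0.
rewrite (_ : subdifferential _ _ = \bigcap_z
    [set zs : dual_space Z | ((zs (z - z0))%:E <= f z - f z0)%E]); last first.
  apply/seteqP; split=> zs; first by case=> _ + z _; exact.
  by move=> zsf; split=> // z; exact: zsf.
apply: closed_bigI => z _; case: (f z - f z0)%E => [r| |].
- rewrite (_ : [set _ | _] =
    (fun zs : dual_space Z => zs (z - z0) : R^o) @^-1` [set x : R^o | x <= r]).
    by apply: closed_comp; [move=> ? _; exact: dual_eval_continuous|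
                            exact: closed_le].
  by apply/seteqP; split=> zs /=; rewrite lee_fin.
- by rewrite (_ : [set _ | _] = setT); [exact: closedT|
    apply/seteqP; split=> zs //= _; rewrite leey].
- by rewrite (_ : [set _ | _] = set0); [exact: closed0|
    apply/seteqP; split=> zs //=; rewrite leeNy_eq].
Qed.

(** The multipliers of the inequalities of [D2] give a functional normal to [D2] on all of [Z]. The
    remainder only has to be nonpositive along directions of [L], since [D1] lies in [L]. *)
Lemma normal_cone_setI (L D1 D2 : set Z) z0 zs :
  affine_subspace L -> polyhedral_in L D1 -> polyhedral_convex_set D2 ->
  normal_cone z0 (D1 `&` D2) zs ->
  exists n1 n2, [/\ normal_cone z0 D1 n1, normal_cone z0 D2 n2 & zs = n1 + n2].
Proof.
move=> Laff [p [a [al D1E]]] [q [b [be D2E]]] [[]].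
rewrite D1E D2E => -[Lz0 az0] [_ bz0] zsN.
pose W := [set d | L (z0 + d)].
have WZ t x : W x -> W (t *: x).
  move=> Wx; have := Laff _ _ t Lz0 Wx.
  by congr L; rewrite scalerDr addrA -scalerDl subrK scale1r.
(* [z0 + (t *: x + y)] is the midpoint of [z0 + (2 * t) *: x] and [z0 + 2 *: y]. *)
have Wlin t x y : W x -> W y -> W (t *: x + y).
  move=> /(WZ (2 * t)) Wx /(WZ 2) Wy; have := Laff _ _ 2^-1 Wx Wy.
  congr L; rewrite !scalerDr !scalerA addrACA -scalerDl subrK scale1r.
  by rewrite mulVf// scale1r; congr (_ + (_ *: _ + _)); field.
have splitl j : fintype.split (lshift q j : 'I_(p + q)) = inl j :=
  unsplitK (inl j).
have splitr j : fintype.split (rshift p j : 'I_(p + q)) = inr j :=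
  unsplitK (inr j).
pose c (i : 'I_(p + q)) : dual_space Z :=
  match fintype.split i with inl i => a i | inr j => b j end.
(* Slacks at [z0]: for [x] in [W], the bounds [c i x <= s i] say that [z0 + x] lies in both sets. *)
pose s i := match fintype.split i with
  inl i => al i - a i z0 | inr j => be j - b j z0 end.
have s_ge0 i : 0 <= s i by rewrite /s; case: fintype.split => j; rewrite subr_ge0.
have [x Wx cx|lam [lam_ge0 lams zsE]] := @farkas R Z (p + q)
    (fun i => functional (c i)) s (functional zs) W Wlin s_ge0.
  rewrite -[x](addKr z0) addrC; apply: zsN; split; split=> //.
  - move=> i; have := cx (lshift q i); rewrite /c /s splitl.
    by rewrite linearD /= lerBrDl.
  - move=> i; have := cx (rshift p i); rewrite /c /s splitr.
    by rewrite linearD /= lerBrDl.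
pose n2 := \sum_j lam (rshift p j) *: b j.
exists (zs - n2), n2; split; last by rewrite subrK.
- split=> // z [Lz az]; rewrite dualDE dualNE zsE; last first.
    by rewrite /W /= addrC subrK.
  rewrite big_split_ord /= dual_sumE.
  rewrite [X in _ + X - _](_ : _ = \sum_j (lam (rshift p j) *: b j) (z - z0)).
    (* By complementarity the bound 0 equals [lam i] times the slack, and feasibility of [z] bounds
       [a i (z - z0)] by that slack. *)
    rewrite addrK; apply: sumr_le0 => i _; rewrite -(lams (lshift q i)).
    by rewrite ler_wpM2l// /c /s splitl linearB /= lerD2r.
  by apply: eq_bigr => j _; rewrite /c splitr.
- split=> // z [_ bz]; rewrite dual_sumE.
  apply: sumr_le0 => i _; rewrite -(lams (rshift p i)).
  by rewrite dualZE ler_wpM2l// /s splitr linearB /= lerD2r.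
Qed.

End Dual.

Lemma dual_pairD (R : realType) (X Y : tvsType R)
    (p q : dual_space X * dual_space Y) :
  dual_pair (p + q) = dual_pair p + dual_pair q.
Proof.
apply: val_inj; apply/funext => z.
exact: (addrACA (p.1 z.1) (q.1 z.1) (p.2 z.2) (q.2 z.2)).
Qed.

(** * The exact sum rule, via epigraphs and cylinders *)

Section SumRule.
Context {R : realType} {Z : tvsType R}.
Implicit Types (phi : Z -> \bar R) (C : set Z).

Definition constrained_fun phi C : Z -> \bar R :=
  fun z => if z \in C then phi z else +oo%E.

Lemma polyhedral_in_cylinder (L C : set Z) : polyhedral_in L C ->
  polyhedral_in (fst @^-1` L : set (Z * R^o)) (fst @^-1` C).
Proof.
move=> [p [c [g ->]]]; exists p, (fun i => dual_pair (c i, 0)), g.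
by apply/seteqP; split=> z [Lz cz]; split=> // i; have := cz i;
  rewrite /= addr0.
Qed.

Lemma affine_cylinder (L : set Z) : affine_subspace L ->
  affine_subspace (fst @^-1` L : set (Z * R^o)).
Proof. by move=> Laff x y t; exact: Laff. Qed.

(** [normal_cone_setI] takes the set with the affine part first: this is the cylinder in one case
    and the epigraph in the other. *)
Lemma normal_cone_epi_cylinder phi C z0 zs :
  (polyhedral_convex_fun phi /\ gen_polyhedral_convex_set C) \/
  (gen_polyhedral_convex_fun phi /\ polyhedral_convex_set C) ->
  normal_cone z0 (epi phi `&` fst @^-1` C) zs ->
  exists n1 n2, [/\ normal_cone z0 (epi phi) n1,
    normal_cone z0 (fst @^-1` C : set (Z * R^o)) n2 & zs = n1 + n2].
Proof.
case=> [[phiP [L [_ Laff CP]]]|[[L [_ Laff phiP]] CP]].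
  rewrite setIC => /(normal_cone_setI (affine_cylinder Laff)
    (polyhedral_in_cylinder CP) phiP)[n2 [n1 [? ? ->]]].
  by exists n1, n2; rewrite addrC.
move/(normal_cone_setI Laff phiP); apply.
exact: polyhedral_in_cylinder CP.
Qed.

Lemma dual_neg_id_subproof :
  (fun r : R^o => - r : R^o) \in @continuous_functional R R^o.
Proof.
apply/asboolP; split=> [a u v|]; first by rewrite scalerN opprD.
by move=> r; apply: (@cvgN _ R^o); exact: cvg_id.
Qed.

(** The slope -1 of the vertical component: [zs] is a subgradient at [z0] exactly when the pair
    [(zs, -1)] is normal to the epigraph above [z0]. *)
Definition dual_neg_id : dual_space R^o := Dual dual_neg_id_subproof.

Lemma subdifferential_sum_rule phi C z0 :
  proper_fun phi -> C z0 -> phi z0 \is a fin_num ->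
  (polyhedral_convex_fun phi /\ gen_polyhedral_convex_set C) \/
  (gen_polyhedral_convex_fun phi /\ polyhedral_convex_set C) ->
  [set z1 + z2 | z1 in subdifferential phi z0 & z2 in normal_cone z0 C] =
  subdifferential (constrained_fun phi C) z0.
Proof.
move=> [_ phiNy] Cz0 phiz0 hyp.
have phi0E : constrained_fun phi C z0 = phi z0.
  by rewrite /constrained_fun mem_set.
apply/seteqP; split=> [_ [z1 [_ z1P] [z2 [_ z2P] <-]]|zs [_ zsP]].
  split=> [|z]; rewrite phi0E// /constrained_fun.
  case: ifPn => [/set_mem Cz|_]; last by rewrite leeBrDr// leey.
  rewrite dualDE EFinD (le_trans _ (z1P z))// geeDl// lee_fin.
  exact: z2P.
have epi0 : epi phi (z0, fine (phi z0)) by rewrite /epi /= fineK.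
have [|n1 [n2 [[_ n1P] [_ n2P] nE]]] := @normal_cone_epi_cylinder phi C
    (z0, fine (phi z0)) (dual_pair (zs, dual_neg_id)) hyp.
  split=> // -[z r] [/= phizr Cz].
  have := zsP z; rewrite phi0E /constrained_fun mem_set//.
  rewrite leeBrDr// => /le_trans /(_ phizr).
  rewrite -(fineK phiz0) -EFinD lee_fin /=; lra.
have [h h1 h2] := @dual_pair_bij R Z R^o.
move: n1P n2P nE; rewrite -(h2 n1) -(h2 n2) -dual_pairD.
case: (h n1) (h n2) => m1 k1 [m2 k2] n1P n2P /(can_inj h1) E.
have /= zsE := congr1 fst E; have /= k12 := congr1 snd E.
(* the cylinder [fst @^-1` C] contains vertical lines *)
have k2_1 : k2 1 = 0.
  have := n2P (z0, fine (phi z0) + 1) Cz0.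
  have := n2P (z0, fine (phi z0) - 1) Cz0.
  rewrite /= !subrr !linear0 !add0r.
  rewrite [_ + 1]addrC [_ - 1]addrC !addrK linearN /=.
  lra.
have k2_0 r : k2 r = 0.
  by rewrite -[r]mulr1 -[r * 1]/(r *: (1 : R^o)) linearZ /= k2_1 scaler0.
have k1E r : k1 r = - r.
  have := congr1 (fun k : dual_space R^o => k r) k12.
  by rewrite dualDE k2_0 addr0 => <-.
exists m1; last exists m2; last by rewrite zsE.
(* When [phi z] is finite, normality of [(m1, -1)] is tested at the graph point [(z, phi z)];
   properness excludes the value [-oo]. *)
- split=> // z; rewrite leeBrDr//.
  case phizE : (phi z) => [r| |].
  + have := n1P (z, r); rewrite /epi /= phizE lexx => /(_ erefl).
    rewrite k1E -{2}(fineK phiz0) -EFinD lee_fin; lra.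
  + by rewrite leey.
  + by move: (phiNy z); rewrite phizE eqxx.
- split=> // z Cz; have := n2P (z, 0) Cz.
  by rewrite /= k2_0 addr0.
Qed.

End SumRule.

(** The left side of the inequality for [(xs, 0)] does not involve [y], so it holds for all [y] in
    [G x] iff it holds for the infimum; both functions agree at the base point because [y0] is a
    solution. *)
Lemma subdifferential_optimal_value (R : realType) (X Y : tvsType R)
    (phi : X * Y -> \bar R) (G : X -> set Y) (x0 : X) (y0 : Y)
    (xs : dual_space X) :
  optimal_value phi G x0 \is a fin_num -> solution_map phi G x0 y0 ->
  subdifferential (optimal_value phi G) x0 xs <->
  subdifferential (constrained_fun phi (gph G)) (x0, y0) (dual_pair (xs, 0)).
Proof.
move=> mu0 [Gy0 muE].
have phi0E : constrained_fun phi (gph G) (x0, y0) = optimal_value phi G x0.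
  by rewrite /constrained_fun mem_set.
split=> [[_ xsP]|[_ xsP]].
  split=> [|[x y]]; rewrite phi0E//=.
  rewrite /constrained_fun; case: ifPn => [/set_mem Gxy|_]; last first.
    by rewrite leeBrDr// leey.
  rewrite addr0 (le_trans (xsP x))// leeB//.
  by apply: ereal_inf_lbound; exists y.
split=> // x; rewrite leeBrDr//; apply: le_ereal_inf_tmp => _ [y Gxy <-].
have := xsP (x, y); rewrite phi0E /constrained_fun mem_set//=.
by rewrite addr0 leeBrDr.
Qed.

Theorem theorem5p1 (R : realType) (X Y : tvsType R)
  (hausX : hausdorff_space X) (hausY : hausdorff_space Y)
  (phi : X * Y -> \bar R) (G : X -> set Y)
  (hyp : (proper_fun phi /\ polyhedral_convex_fun phi /\
            gen_polyhedral_convex_map G)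
         \/
         (proper_fun phi /\ gen_polyhedral_convex_fun phi /\
            polyhedral_convex_map G))
  (x0 : X) (hmu : optimal_value phi G x0 \is a fin_num)
  (y0 : Y) (hy0 : solution_map phi G x0 y0) :
  let dphi := subdifferential phi (x0, y0) in
  let N := normal_cone (x0, y0) (gph G) in
  let S := [set z1 + z2 | z1 in dphi & z2 in N] in
  let A0 := \bigcup_(p in @dual_pair R X Y @^-1` dphi)
              [set p.1 + xs | xs in coderivative G x0 y0 p.2] in
  let A := closure A0 in
  let B0 := fst @` (@dual_pair R X Y @^-1` S `&` [set p | p.2 = 0]) in
  let B := fst @` (@dual_pair R X Y @^-1` closure S `&` [set p | p.2 = 0]) in
  [/\ subdifferential (optimal_value phi G) x0 = A0, A0 = A, A = B0 & B0 = B].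
Proof.
move=> dphi N S A0 A B0 B.
have [Gy0 muE] := hy0; have mu0 := hmu.
have SE : S = subdifferential (constrained_fun phi (gph G)) (x0, y0).
  apply: subdifferential_sum_rule => //.
  - by case: hyp => -[].
  - by rewrite -muE.
  - by case: hyp => -[_ ?]; [left|right].
have muB0 : subdifferential (optimal_value phi G) x0 = B0.
  apply/seteqP; split=> [xs|_ [[xs ys] [/= + ys0] <-]].
    move=> /(subdifferential_optimal_value _ mu0 hy0) xsS.
    by exists (xs, 0) => //; split=> //=; rewrite SE.
  by rewrite ys0 SE => /(subdifferential_optimal_value _ mu0 hy0).
(* A subgradient [(x1, y1)] plus a normal [(x2, y2)] has zero second component iff [y2 = - y1],
   which is the sign convention of the coderivative. *)
have A0B0 : A0 = B0.
  apply/seteqP; split.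
    move=> _ [[x1 y1] /= pP [x2 x2N <-]].
    exists (x1 + x2, 0) => //; split=> //=; exists (dual_pair (x1, y1)) => //.
    exists (dual_pair (x2, - y1)) => //.
    by rewrite -dual_pairD; congr (dual_pair (_, _)); rewrite subrr.
  have [h h1 h2] := @dual_pair_bij R X Y.
  move=> _ [[xs ys] [/= [z1 z1P [z2 z2P zE]] ys0] <-] /=.
  move: z1P z2P zE; rewrite ys0 -(h2 z1) -(h2 z2) -dual_pairD.
  case: (h z1) (h z2) => x1 y1 [x2 y2] z1P z2P /(can_inj h1) E.
  have /= <- := congr1 fst E; have /= /eqP := congr1 snd E.
  rewrite addrC addr_eq0 => /eqP y2E.
  exists (x1, y1) => //; exists x2 => //.
  by rewrite /coderivative /= -y2E.
(* The closures add nothing: [A0] and [S] are both subdifferentials, hence weak* closed. *)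
have AE : A0 = A.
  by rewrite /A A0B0 -muB0; apply/closure_id; exact: subdifferential_closed.
have closS : S = closure S.
  by rewrite SE; apply/closure_id; exact: subdifferential_closed.
split=> //; first by rewrite muB0.
  by rewrite -AE.
by rewrite /B -closS.
Qed.
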